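(* Let $d\geq 2$ and let $\rho=(\rho_1,\ldots,\rho_d)\in\mathbb{R}^d$ be any totally irrational vector. Then there exists an irrational pseudo-rotation $f\in\mathrm{Homeo}_0(\mathbb{T}^d)$ which has rotation vector $\rho$ (that is, $\rho(F)=\{\rho\}$ for some lift $F$ of $f$) and bounded mean motion, but which is not semi-conjugate to the irrational rotation $R_\rho:\mathbb{T}^d\to\mathbb{T}^d$.
   Context: $\mathbb{T}^d=\mathbb{R}^d/\mathbb{Z}^d$ with quotient map $\pi:\mathbb{R}^d\to\mathbb{T}^d$. $\mathrm{Homeo}_0(\mathbb{T}^d)$ is the set of homeomorphisms of $\mathbb{T}^d$ homotopic to the identity. A lift of $f$ is a continuous $F:\mathbb{R}^d\to\mathbb{R}^d$ with $\pi\circ F=f\circ\pi$ (then $F(z+k)=F(z)+k$ for $k\in\mathbb{Z}^d$). The rotation set of $F$ is $\rho(F)=\{\rho\in\mathbb{R}^d \mid \exists\, n_i\nearrow\infty,\ z_i\in\mathbb{R}^d:\ \lim_{i\to\infty}(F^{n_i}(z_i)-z_i)/n_i=\rho\}$. A vector $\rho=(\rho_1,\ldots,\rho_d)$ is totally irrational if $1,\rho_1,\ldots,\rho_d$ are linearly independent over $\mathbb{Q}$. $f$ is an irrational pseudo-rotation if $\rho(F)$ consists of a single, totally irrational vector $\rho$. In this case $f$ has bounded mean motion if the vectors $D(n,z)=F^n(z)-z-n\rho$ are bounded uniformly in $n$ and $z$. $R_\rho$ is the rotation $z\mapsto z+\rho \bmod 1$ on $\mathbb{T}^d$. $f$ is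 semi-conjugate to $R_\rho$ if there is a continuous surjective map $\psi:\mathbb{T}^d\to\mathbb{T}^d$ with $\psi\circ f=R_\rho\circ\psi$. *)

(* Defs.v *)
From HB Require Import structures.
From mathcomp Require Import all_boot all_order all_algebra.
From mathcomp Require Import generic_quotient archimedean.
From mathcomp Require Import all_classical all_reals all_analysis.

Set Implicit Arguments.
Unset Strict Implicit.
Unset Printing Implicit Defensive.

Import Order.TTheory GRing.Theory Num.Theory.
Import numFieldNormedType.Exports.

Local Open Scope classical_set_scope.
Local Open Scope ring_scope.
Local Open Scope quotient_scope.

Section torus.
Variables (R : realType) (d : nat).

Definition torus_rel : rel 'rV[R]_d :=
  fun x y => [forall i, (x - y) ord0 i \is a Num.int].

Lemma torus_rel_refl : reflexive torus_rel.
Proof. by move=> x; apply/forallP => i; rewrite subrr mxE rpred0. Qed.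

Lemma torus_rel_sym : symmetric torus_rel.
Proof.
by move=> x y; apply: eq_forallb => i; rewrite -opprB mxE rpredN.
Qed.

Lemma torus_rel_trans : transitive torus_rel.
Proof.
move=> y x z /forallP xy /forallP yz; apply/forallP => i.
by rewrite -(subrKA y) mxE rpredD.
Qed.

Canonical torus_equiv :=
  EquivRel torus_rel torus_rel_refl torus_rel_sym torus_rel_trans.

Definition torus : Type := {eq_quot torus_equiv}.

HB.instance Definition _ := Topological.copy torus (quotient_topology torus).
HB.instance Definition _ := EqQuotient.on torus.

Definition torus_pi : 'rV[R]_d -> torus := \pi_torus.

Lemma torus_piE (x y : 'rV[R]_d) :
  (torus_pi x = torus_pi y) <-> (forall i, (x - y) ord0 i \is a Num.int).
Proof.
by split=> [/eqmodP/forallP //|xy]; apply/eqmodP/forallP.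
Qed.

Lemma torus_pi_surj (x : torus) : exists z, torus_pi z = x.
Proof. by exists (repr x); rewrite /torus_pi reprK. Qed.

(* The rotation R_rho, defined through a representative; torus_rotE shows that
   the choice is immaterial. *)
Definition torus_rot (rho : 'rV[R]_d) (x : torus) : torus :=
  torus_pi (repr x + rho).

Lemma torus_rotE rho z : torus_rot rho (torus_pi z) = torus_pi (z + rho).
Proof.
apply/torus_piE => i; rewrite opprD addrACA subrr addr0.
by move: i; apply/torus_piE; rewrite /torus_pi reprK.
Qed.

End torus.

Definition homeomorphism (X Y : topologicalType) (f : X -> Y) : Prop :=
  continuous f /\ exists g : Y -> X, [/\ continuous g, cancel f g & cancel g f].

Definition homotopic (R : realType) (X Y : topologicalType) (f g : X -> Y) :
    Prop :=
  exists H : R * X -> Y,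
    [/\ {within `[0, 1] `*` setT, continuous H},
        forall x, H (0, x) = f x & forall x, H (1, x) = g x].

Definition semi_conjugate (X Y : topologicalType) (f : X -> X) (g : Y -> Y) :
    Prop :=
  exists psi : X -> Y,
    [/\ continuous psi, (forall y, exists x, psi x = y) & psi \o f = g \o psi].

Section pseudo_rotation.
Variables (R : realType) (d : nat).
Implicit Types (f : torus R d -> torus R d) (F : 'rV[R]_d -> 'rV[R]_d)
  (rho : 'rV[R]_d).

Definition Homeo0 f : Prop := homeomorphism f /\ homotopic R f id.

Definition is_lift F f : Prop :=
  continuous F /\ @torus_pi R d \o F = f \o @torus_pi R d.

Definition rotation_set F : set 'rV[R]_d :=
  [set rho | exists (n_ : nat -> nat) (z_ : nat -> 'rV[R]_d),
    [/\ nondecreasing_seq n_, n_ @ \oo --> \oo &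
        (n_ i)%:R^-1 *: (iter (n_ i) F (z_ i) - z_ i) @[i --> \oo] --> rho]].

Definition totally_irrational rho : Prop :=
  forall (q0 : rat) (q : 'I_d -> rat),
    ratr q0 + \sum_(i < d) ratr (q i) * rho ord0 i = 0 ->
    q0 = 0 /\ forall i, q i = 0.

Definition irrational_pseudo_rotation f F rho : Prop :=
  [/\ Homeo0 f, is_lift F f, rotation_set F = [set rho] &
      totally_irrational rho].

Definition bounded_mean_motion F rho : Prop :=
  exists M : R, forall (n : nat) (z : 'rV[R]_d),
    `|iter n F z - z - n%:R *: rho| <= M.

End pseudo_rotation.

(* Main.v *)
Require Import Defs.
From mathcomp Require Import all_boot all_order all_algebra.
From mathcomp Require Import archimedean ring lra zify.
From mathcomp Require Import all_classical all_reals all_analysis.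

Set Implicit Arguments.
Unset Strict Implicit.
Unset Printing Implicit Defensive.

Import Order.TTheory GRing.Theory Num.Theory.
Import numFieldNormedType.Exports.

Local Open Scope classical_set_scope.
Local Open Scope ring_scope.

(** A homeomorphism of the circle with rotation number a = rho_0 that has a
    wandering interval (Denjoy's example) is extended by translations in the
    other coordinates: f (x, y) = (g x, y + rho' + tau x), where tau is supported
    in one wandering interval and its values there run along every coordinate
    axis.  Each orbit meets the support of tau at most once, so the mean motion
    is bounded.  Suppose that psi is a semi-conjugacy.  The wandering interval
    returns close to its own right end x* both in the future, after being
    translated by tau, and in the past, where it has not been translated; hence
    psi (x*, y) = psi (x*, y + tau x) for all x in the interval, and psi (x*, _)
    is constant.  Then n rho_0 -> 0+ mod 1 forces n rho_1 -> 0 mod 1, so rho_1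
    is an integer combination of rho_0 and 1. *)

(** * Approximation by integers *)

Lemma int_norm_lt1 (j : int) : `|j| < 1 -> j = 0.
Proof. lia. Qed.

Section diophantine.
Variable R : archiRealFieldType.
Implicit Types (a b v c : R).

Definition incommensurable a := forall (n : nat) (k : int),
  n%:R * a + k%:~R = 0 -> n = 0%N.

Lemma incommensurableN a : incommensurable a -> incommensurable (- a).
Proof.
move=> ia n k e; apply: (ia n (- k)); rewrite intrN.
by apply/eqP; rewrite -oppr_eq0 opprB addrC -mulrN e.
Qed.

Lemma incommensurable_intmul a (n k : int) : incommensurable a ->
  n%:~R * a + k%:~R = 0 -> n = 0.
Proof.
move=> ia; case: n => n e; first by rewrite (ia n k).
suff : n.+1 = 0%N by [].
apply: (ia _ (- k)); move: e; rewrite NegzE !intrN mulNr -pmulrn => e.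
by rewrite -[RHS]oppr0 -e opprD opprK.
Qed.

Lemma exists_natmul_itv v c : 0 < v -> 0 <= c ->
  exists j : nat, j%:R * v <= c < j.+1%:R * v.
Proof.
move=> v0 c0; exists (Num.truncn (c / v)).
have cv : 0 <= c / v by rewrite divr_ge0 // ltW.
by rewrite -ler_pdivlMr // -ltr_pdivrMr // truncn_itv.
Qed.

Let P a p := exists (n : nat) (k : int), p = n.+1%:R * a + k%:~R /\ 0 < p.

Let P_half a p : incommensurable a -> P a p -> exists2 q, P a q & q <= p / 2.
Proof.
move=> ia [n [k [pE p0]]].
have [j /andP[jp pj]] := exists_natmul_itv p0 ler01.
set q := j.+1%:R * p - 1.
have Pq : P a q.
  exists (j.+1 * n.+1).-1, (j.+1%:Z * k - 1); split; last by rewrite subr_gt0.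
  by rewrite prednK ?muln_gt0 // /q pE intrB intrM natrM; ring.
have [qp|pq] := leP q (p / 2); first by exists q.
set r := 1 - j%:R * p.
have r0 : r != 0.
  apply/eqP => r0.
  have /eqP : (j * n.+1)%N = 0%N.
    apply: (ia _ (j%:Z * k - 1)); rewrite intrB intrM natrM -[RHS]oppr0 -r0 /r pE.
    by rewrite -pmulrn; ring.
  rewrite muln_eq0 orbF => /eqP j0; move: r0; rewrite /r j0 mul0r subr0.
  by move/eqP; rewrite oner_eq0.
have r_gt0 : 0 < r by rewrite lt_def r0 subr_ge0.
have rp : r < p / 2 by move: pq; rewrite /q /r -[j.+1%:R]natr1; lra.
(* The remainder of [p] modulo [r] is below [p / 2]. As [r] is [1 - j%:R * p], subtracting copies of
   it only raises the coefficient of [a], which stays positive. *)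
have [i /andP[ip pi]] := exists_natmul_itv r_gt0 (ltW p0).
have sE : p - i%:R * r =
    (i * j).+1%:R * n.+1%:R * a + ((i * j).+1%:Z * k - i%:Z)%:~R.
  by rewrite /r intrB intrM -!pmulrn -!natr1 natrM pE -!natr1; ring.
exists (p - i%:R * r); last by move: pi; rewrite -natr1; lra.
exists ((i * j).+1 * n.+1).-1, ((i * j).+1%:Z * k - i%:Z).
rewrite prednK ?muln_gt0 // natrM; split=> //.
rewrite lt_def subr_ge0 ip andbT; apply/eqP => s0.
by move: s0; rewrite sE -natrM => /ia.
Qed.

(* Every positive value p of (n + 1) a + k is beaten by another one that is at
   most p / 2: it is either the overshoot of the multiples of p past 1, or
   obtained by subtracting multiples of the (then small) undershoot. *)
Lemma incommensurable_approx a (e : R) : incommensurable a -> 0 < e ->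
  exists (n : nat) (k : int), 0 < n.+1%:R * a + k%:~R < e.
Proof.
move=> ia e0.
pose p0 : R := 1%:R * a + (1 - Num.floor a)%:~R.
have Pp0 : P a p0.
  exists 0%N, (1 - Num.floor a); split=> //.
  by rewrite /p0 intrB; move: (floor_le a); lra.
have Pm (m : nat) : exists2 q, P a q & q <= p0 / 2 ^+ m.
  elim: m => [|m [q Pq qm]]; first by exists p0; rewrite // expr0 divr1.
  have [q' Pq' q'm] := P_half ia Pq; exists q' => //.
  apply: le_trans q'm _; rewrite exprSr invfM mulrA; lra.
have [_ [_ [_ p0_gt0]]] := Pp0.
have [m mP] : exists m : nat, p0 / e < 2 ^+ m.
  exists (Num.truncn (p0 / e)).+1; apply: lt_trans (truncnS_gt _) _.
  by rewrite -natrX ltr_nat ltn_expl.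
have [q [n [k [qE q0]]] qm] := Pm m.
exists n, k; rewrite -qE q0 /=; apply: le_lt_trans qm _.
by rewrite ltr_pdivrMr ?exprn_gt0 // mulrC -ltr_pdivrMr.
Qed.

(** Distance on the circle, computed on representatives: its vanishing expresses congruence modulo 1
    and combines with estimates by the triangle inequality. *)
Definition dist_int (x : R) : R := `|x - (Num.floor (x + 2^-1))%:~R|.

Lemma dist_int_le x (k : int) : dist_int x <= `|x - k%:~R|.
Proof.
rewrite /dist_int; have /andP[] := floor_itv (x + 2^-1).
set f := Num.floor _; rewrite intrD1 => fx xf.
have [fk|kf|-> //] := ltgtP f k.
  have fk1 : (f + 1)%:~R <= k%:~R :> R by rewrite ler_int lezD1.
  rewrite intrD1 in fk1; apply: (@le_trans _ _ 2^-1).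
    by rewrite ler_norml; lra.
  by rewrite distrC; apply: le_trans (ler_norm _); lra.
have kf1 : (k + 1)%:~R <= f%:~R :> R by rewrite ler_int lezD1.
rewrite intrD1 in kf1; apply: (@le_trans _ _ 2^-1).
  by rewrite ler_norml; lra.
by apply: le_trans (ler_norm _); lra.
Qed.

Lemma dist_intP x : exists k : int, dist_int x = `|x - k%:~R|.
Proof. by eexists. Qed.

Lemma dist_intDz x (k : int) : dist_int (x + k%:~R) = dist_int x.
Proof.
have le y (l : int) : dist_int (y + l%:~R) <= dist_int y.
  have [i ->] := dist_intP y.
  apply: le_trans (dist_int_le _ (i + l)) _.
  by rewrite intrD opprD addrACA subrr addr0.
apply/eqP; rewrite eq_le le /=.
by rewrite -{1}[x](addrK k%:~R) -intrN le.
Qed.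

Lemma dist_int_ge0 x : 0 <= dist_int x.
Proof. exact: normr_ge0. Qed.

Lemma dist_intN x : dist_int (- x) = dist_int x.
Proof.
have le y : dist_int (- y) <= dist_int y.
  have [k ->] := dist_intP y; apply: le_trans (dist_int_le _ (- k)) _.
  by rewrite intrN -opprD normrN.
by apply/eqP; rewrite eq_le le -{1}[x]opprK le.
Qed.

Lemma dist_intD x y : dist_int (x + y) <= dist_int x + dist_int y.
Proof.
have [k ->] := dist_intP x; have [l ->] := dist_intP y.
apply: le_trans (dist_int_le _ (k + l)) _.
by rewrite intrD opprD addrACA ler_normD.
Qed.

Lemma dist_int_int (x : R) : x \is a Num.int -> dist_int x = 0.
Proof.
move=> /intrP[k ->]; apply/eqP; rewrite eq_le dist_int_ge0 andbT.
by rewrite -(normr0 R) -(subrr k%:~R) dist_int_le.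
Qed.

Lemma dist_int_lip x y : dist_int x <= dist_int y + `|x - y|.
Proof.
have [k ->] := dist_intP y; apply: le_trans (dist_int_le x k) _.
rewrite [leRHS]addrC; apply: le_trans (ler_normD _ _).
by rewrite addrA subrK.
Qed.

Lemma dist_int_small x : `|x| <= 2^-1 -> dist_int x = `|x|.
Proof.
move=> x2; apply/eqP; rewrite eq_le -{2}[x]subr0 -[0]/(0%:~R) dist_int_le /=.
have [k ->] := dist_intP x; have [->|k0] := eqVneq k 0; first by rewrite subr0.
have : 1 <= `|k%:~R| :> R by rewrite -intr_norm ler1z; lia.
move=> k1; have : `|k%:~R| <= `|x| + `|x - k%:~R|.
  by rewrite -{1}[k%:~R](subKr x); apply: ler_normB.
lra.
Qed.

(** For each of the finitely many [u] the infimum over [w] is attained at a nearest integer, hence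
    positive. *)
Lemma dist_int_lower_bound (x y : R) (M : nat) :
  (forall u w : int, u%:~R * x - y - w%:~R != 0) ->
  exists2 eta : R, 0 < eta &
    forall u w : int, `|u| <= M%:Z -> eta <= `|u%:~R * x - y - w%:~R|.
Proof.
move=> neq0.
have one z : (forall w : int, z - w%:~R != 0) ->
    exists2 eta : R, 0 < eta & forall w : int, eta <= `|z - w%:~R|.
  move=> z0; exists (dist_int z); last exact: dist_int_le.
  by have [k ->] := dist_intP z; rewrite normr_gt0.
elim: M => [|M [eta eta0 IH]].
  have [eta eta0 H] := one (0%:~R * x - y) (neq0 0).
  by exists eta => // u w; rewrite normr_le0 => /eqP ->.
have [e1 e10 H1] := one _ (neq0 M.+1%:Z).
have [e2 e20 H2] := one _ (neq0 (- M.+1%:Z)).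
exists (Num.min eta (Num.min e1 e2)); first by rewrite !lt_min eta0 e10 e20.
move=> u w uM; rewrite !ge_min.
have [/IH -> //|Mu] := leP `|u| M%:Z.
have [->|->] : u = M.+1%:Z \/ u = - M.+1%:Z by lia.
  by rewrite H1 orbT.
by rewrite H2 !orbT.
Qed.

(* If n a + k |-> n b mod 1 is continuous at 0, it is the restriction of a
   continuous homomorphism of the circle, that is, a multiplication by an
   integer.  The slope lam = (N b - J) / (N a + k), for small N a + k, is
   nearly an integer u because 1 is nearly a multiple of N a + k, and u a' - b
   is nearly an integer because a' = a + K is nearly a multiple as well. *)
Lemma modular_continuity_dependent a b : incommensurable a ->
  (forall e : R, 0 < e -> exists2 d : R, 0 < d & forall (n : nat) (k : int),
     0 < n%:R * a + k%:~R < d -> exists j : int, `|n%:R * b - j%:~R| < e) ->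
  exists u w : int, b = u%:~R * a + w%:~R.
Proof.
move=> ia cont; apply: contrapT => nodep.
have [K K0] : exists K : int, 0 < a + K%:~R.
  by exists (1 - Num.floor a); rewrite intrB; move: (floor_le a); lra.
set a' := a + K%:~R in K0.
have [d0 d0_gt0 hd0] := cont 8^-1 ltac:(lra).
pose C := (4 * d0)^-1; have C0 : 0 < C by rewrite invr_gt0; lra.
have [M MP] : exists M : nat, C + 1 < M%:R.
  by exists (Num.truncn (C + 1)).+1; apply: truncnS_gt.
have neq0 (u w : int) : u%:~R * a' - b - w%:~R != 0.
  apply/eqP => e; apply: nodep; exists u, (u * K - w).
  by rewrite intrB intrM; rewrite -[LHS]addr0 -e /a'; ring.
have [eta eta0 etaP] := dist_int_lower_bound M neq0.
(* The bound 1/2 keeps [u] within 1 of [lam], hence below [M]; the other one makes the final error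
   [2 * e * (1 + a')] smaller than [eta]. *)
pose e : R := Num.min (1 / 2) (eta / (4 * (1 + a'))).
have e0 : 0 < e.
  by rewrite lt_min; apply/andP; split; [lra | apply: divr_gt0 => //; lra].
have [d1 d1_gt0 hd1] := cont e e0.
pose d := Num.min (Num.min d0 d1) (e / C).
have d_gt0 : 0 < d by rewrite !lt_min d0_gt0 d1_gt0 divr_gt0.
have [N [k /andP[v0 vd]]] := incommensurable_approx ia d_gt0.
set v := _ + _ in v0 vd.
move: vd; rewrite !lt_min => /andP[/andP[vd0 vd1]].
rewrite ltr_pdivlMr // => vC.
have [J JP] := hd0 N.+1 k ltac:(by rewrite v0 vd0).
set bv := _ - _ in JP.
(* Three errors below 1/8 leave no room for a nonzero integer, so no integer correction appears
   while [i%:R * v] stays below [d0]. *)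
have small i : i%:R * v < d0 -> `|i%:R * bv| < 8^-1.
  elim: i => [|i IH]; first by rewrite !mul0r normr0 => _; lra.
  move=> iv; have iv0 : 0 < i.+1%:R * v by rewrite mulr_gt0.
  have [] := hd0 (i.+1 * N.+1)%N (i.+1%:Z * k).
    by rewrite natrM intrM -mulrA -mulrDr iv0.
  move=> j jP; have jE : (i.+1 * N.+1)%:R * b - j%:~R =
      i.+1%:R * bv + (i.+1%:Z * J - j)%:~R.
    by rewrite /bv natrM intrB intrM; ring.
  rewrite jE in jP; set j' := _ - j in jP.
  have {}IH := IH ltac:(apply: lt_trans iv; rewrite -natr1; lra).
  have j'1 : `|j'%:~R| < 1 :> R.
    by move: jP IH JP; rewrite -natr1 !ltr_norml; lra.
  have j'0 : j' = 0 by move: j'1; rewrite -intr_norm ltrz1 => /int_norm_lt1.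
  by rewrite j'0 addr0 in jP.
(* With [i] the last index such that [i * v < d0], one has [d0 * |bv| <= (i + 1) * v * |bv|], and
   [i * |bv|] and [|bv|] are each below 1/8. *)
have bvC : `|bv| <= C * v.
  have [i /andP[ivd div]] := exists_natmul_itv v0 (ltW d0_gt0).
  have [i' [i'd di']] : exists i : nat, i%:R * v < d0 /\ d0 <= i.+1%:R * v.
    case: (ltgtP (i%:R * v) d0) ivd => // [ivd|ivd] _.
      by exists i; split; rewrite // ltW.
    case: i => [|i] in ivd div *; first by move: d0_gt0; rewrite -ivd mul0r ltxx.
    by exists i; rewrite ivd lexx -ivd -natr1; split=> //; lra.
  have := small _ i'd; rewrite normrM normr_nat => ib.
  have : d0 * `|bv| <= (1 / 4) * v.
    apply: (@le_trans _ _ (i'.+1%:R * v * `|bv|)); first exact: ler_wpM2r.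
    by rewrite -natr1; nra.
  have -> : C * v = (1 / 4 * v) / d0 by rewrite /C; field; rewrite gt_eqF.
  by rewrite ler_pdivlMr // mulrC.
pose lam := bv / v.
have lamv : lam * v = bv by rewrite /lam divfK // gt_eqF.
have lamC : `|lam| <= C by rewrite normrM normfV (gtr0_norm v0) ler_pdivrMr.
(* The multiple of [v] just past 1, and later the one just past [a'], overshoots by at most [v],
   which costs at most [|bv| < e] after multiplication by [lam]. *)
have [j /andP[jv1 jv2]] := exists_natmul_itv v0 ler01.
have [] := hd1 (j.+1 * N.+1)%N (j.+1%:Z * k - 1).
  rewrite natrM intrB intrM; move: jv1 jv2 vd1; rewrite /v -!natr1.
  set x := N%:R; set y := k%:~R; set z := j%:R => *.
  apply/andP; split; nra.
move=> j1 j1P.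
pose u := j1 - j.+1%:Z * J.
have uE : (j.+1 * N.+1)%:R * b - j1%:~R = j.+1%:R * bv - u%:~R.
  by rewrite /u /bv natrM intrB intrM; ring.
rewrite uE in j1P.
have lamu : `|lam - u%:~R| < e + e.
  have : `|j.+1%:R * bv - lam| <= `|bv|.
    rewrite -lamv mulrCA -{2}[lam]mulr1 -mulrBr !normrM ler_wpM2l //.
    by rewrite (gtr0_norm v0) ler_norml; move: jv1 jv2; rewrite -natr1; lra.
  by move: j1P; rewrite !ltr_norml !ler_norml; move: bvC vC; lra.
have [i /andP[iv1 iv2]] := exists_natmul_itv v0 (ltW K0).
(* The predecessor and [- K] together remove one [a']: the value is [i.+1%:R * v - a'], and the
   multiple of [b] loses one [b]. *)
have [] := hd1 (i.+1 * N.+1).-1 (i.+1%:Z * k - K).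
  rewrite -subn1 natrB ?muln_gt0 // natrM intrB intrM.
  move: iv1 iv2 vd1; rewrite /v /a' -!natr1.
  set x := N%:R; set y := k%:~R; set z := i%:R => *.
  apply/andP; split; nra.
move=> i1 i1P.
pose w := i1 - i.+1%:Z * J.
have wE : (i.+1 * N.+1).-1%:R * b - i1%:~R = i.+1%:R * bv - b - w%:~R.
  by rewrite -subn1 natrB ?muln_gt0 // /w /bv natrM intrB intrM; ring.
rewrite wE in i1P.
have lamw : `|lam * a' - b - w%:~R| < e + e.
  have : `|i.+1%:R * bv - lam * a'| <= `|bv|.
    rewrite -lamv mulrCA -mulrBr !normrM ler_wpM2l //.
    by rewrite (gtr0_norm v0) ler_norml; move: iv1 iv2; rewrite -natr1; lra.
  by move: i1P; rewrite !ltr_norml !ler_norml; move: bvC vC; lra.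
have e12 : e <= 1 / 2 by rewrite ge_min lexx.
have uM : `|u| <= M%:Z.
  rewrite -(ler_int R) intr_norm; move: lamu lamC MP.
  by rewrite !ler_norml !ltr_norml -pmulrn; move: e12; lra.
have := etaP u w uM; apply/negP; rewrite -ltNge.
have -> : u%:~R * a' - b - w%:~R =
  (lam * a' - b - w%:~R) - (lam - u%:~R) * a' by ring.
apply: le_lt_trans (ler_normB _ _) _.
have eeta : e * (4 * (1 + a')) <= eta.
  by rewrite -ler_pdivlMr ?ge_min ?lexx ?orbT //; lra.
rewrite normrM (gtr0_norm K0); nra.
Qed.

End diophantine.

(** * Weighted sums and fractional parts *)

Section weighted_sum.
Variable R : realType.
Implicit Types u w : nat -> R.

(** The weights add up to 1/2: subtracting from [t] such a sum of fractional parts takes away only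
    half of the slope. *)
Definition wsum u : R := limn (series (fun m => geometric 4^-1 2^-1 m * u m)).

Let wt_ge0 m : 0 <= geometric 4^-1 2^-1 m :> R.
Proof. by rewrite geometric_ge0 // invr_ge0. Qed.

Let half_lt1 : `|2^-1| < 1 :> R.
Proof. by rewrite gtr0_norm; lra. Qed.

Lemma is_cvg_wsum u : (forall m, `|u m| <= 1) ->
  cvgn (series (fun m => geometric 4^-1 2^-1 m * u m)).
Proof.
move=> u1; apply: normed_cvg.
apply: (series_le_cvg _ wt_ge0 _ (is_cvg_geometric_series half_lt1)).
  by move=> m /=.
by move=> m /=; rewrite normrM (ger0_norm (wt_ge0 m)) ler_piMr.
Qed.

Lemma wsum_cst (c : R) : wsum (fun=> c) = c / 2.
Proof.
apply/cvg_lim => //.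
have -> : (fun m => geometric 4^-1 2^-1 m * c) = geometric (c / 4) 2^-1.
  by apply/funext => m; rewrite /geometric /=; ring.
have -> : c / 2 = (c / 4) / (1 - 2^-1) by field.
exact: cvg_geometric_series.
Qed.

Lemma wsumB u w : (forall m, `|u m| <= 1) -> (forall m, `|w m| <= 1) ->
  wsum (fun m => u m - w m) = wsum u - wsum w.
Proof.
move=> /is_cvg_wsum cu /is_cvg_wsum cw; rewrite /wsum -lim_seriesB //.
by congr (limn (series _)); apply/funext => m /=; rewrite mulrBr.
Qed.

Lemma le_wsum u w : (forall m, `|u m| <= 1) -> (forall m, `|w m| <= 1) ->
  (forall m, u m <= w m) -> wsum u <= wsum w.
Proof.
move=> /is_cvg_wsum cu /is_cvg_wsum cw uw; apply: lim_series_le => // m.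
exact: ler_wpM2l.
Qed.

Lemma wsum_ge_term u m : (forall m, 0 <= u m <= 1) -> 4^-1 * 2^-1 ^+ m * u m <= wsum u.
Proof.
move=> u01; have cu : cvgn (series (fun m => geometric 4^-1 2^-1 m * u m)).
  by apply: is_cvg_wsum => k; have /andP[? ?] := u01 k; rewrite ger0_norm.
have nd : nondecreasing_seq (series (fun m => geometric 4^-1 2^-1 m * u m)).
  by apply: nondecreasing_series => k _ _; rewrite mulr_ge0 //; have /andP[] := u01 k.
apply: le_trans (nondecreasing_cvgn_le nd cu m.+1).
rewrite /series /= big_nat_recr //= lerDr sumr_ge0 // => k _.
by rewrite mulr_ge0 //; have /andP[] := u01 k.
Qed.

Lemma wsum_tail u M : (forall m, 0 <= u m <= 1) ->
  (forall m, (m < M)%N -> u m = 0) -> wsum u <= 2^-1 ^+ M.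
Proof.
move=> u01 uM; apply: limr_le.
  by apply: is_cvg_wsum => k; have /andP[? ?] := u01 k; rewrite ger0_norm.
(* The term [2^-1 ^+ n] in the induction hypothesis pays for the next summand; the maximum with 0
   covers [n <= M], where the partial sums vanish. *)
apply: nearW => n; suff : series (fun m => geometric 4^-1 2^-1 m * u m) n <=
    Num.max 0 (2^-1 ^+ M - 2^-1 ^+ n).
  move/le_trans; apply; rewrite ge_max exprn_ge0 ?invr_ge0 //=.
  by rewrite gerBl exprn_ge0 ?invr_ge0.
elim: n => [|n IH].
  by rewrite /series /= big_geq // le_max lexx.
rewrite seriesSr /=; have [nM|Mn] := ltnP n M.
  rewrite uM // mulr0 addr0; apply: le_trans IH _.
  rewrite ge_max !le_max lexx /=; apply/orP; right.
  by rewrite lerD2l lerN2 exprS ler_piMl ?exprn_ge0 ?invr_ge0 //; lra.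
have pM : 2^-1 ^+ n <= 2^-1 ^+ M :> R.
  by rewrite ler_wiXn2l // ?invr_ge0 //; lra.
rewrite le_max; apply/orP; right.
have {}IH : series (fun m => geometric 4^-1 2^-1 m * u m) n <= 2^-1 ^+ M - 2^-1 ^+ n.
  by apply: le_trans IH _; rewrite ge_max lexx subr_ge0 pM.
have /andP[un0 un1] := u01 n.
have pn : 0 <= 2^-1 ^+ n :> R by rewrite exprn_ge0 ?invr_ge0.
have key (S p q A : R) :
    S <= A - p -> 0 <= p -> q <= p -> S + 4^-1 * q <= A - 2^-1 * p by lra.
by rewrite exprS /geometric /= -mulrA; apply: key; rewrite // ler_piMr.
Qed.

End weighted_sum.

Section fracpart.
Variable R : archiRealFieldType.
Implicit Types s t : R.

Definition fracpart s : R := s - (Num.floor s)%:~R.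

Lemma frac_itv s : 0 <= fracpart s < 1.
Proof. by have := floor_itv s; rewrite /fracpart intrD1; lra. Qed.

Lemma fracDz s (k : int) : fracpart (s + k%:~R) = fracpart s.
Proof.
rewrite /fracpart floorDrz ?intr_int // intrKfloor intrD; ring.
Qed.

(** [1 - fracpart (- t)] is the left limit of [fracpart] at [t]: it subtracts from [t] the ceiling
    of [t] minus 1, which is at least the floor of [s]. *)
Lemma lfracB s t : s < t -> (1 - fracpart (- t)) - fracpart s <= t - s.
Proof.
move=> st; rewrite /fracpart.
have : Num.floor s < - Num.floor (- t).
  rewrite -(ltr_int R) -ceilNfloor; apply: le_lt_trans (floor_le s) _.
  exact: lt_le_trans st (ceil_ge t).
rewrite -lezD1 -(ler_int R) intrD1 intrN; lra.
Qed.

Lemma lfrac_frac s : (1 - fracpart (- s)) - fracpart s = (s \is a Num.int)%:R.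
Proof.
rewrite /fracpart; have := ceil_floor s; rewrite ceilNfloor => /eqP.
rewrite -(eqr_int R) intrD intrN => /eqP.
case: (s \is a Num.int) => /=; rewrite ?mulr1z ?mulr0z; lra.
Qed.

End fracpart.

(** * Denjoy's homeomorphism *)

(** Comparing [f w] with [z] amounts to comparing [w] with [g z], so preimages of open rays are open
    rays. *)
Lemma increasing_surjective_continuous (R : realType) (f g : R -> R) :
  {homo f : x y / x < y} -> cancel g f -> continuous f.
Proof.
move=> fi gK x; have fle : {mono f : x y / x <= y} by exact: le_mono.
have fg z w : (g z < w) = (z < f w) by rewrite -(leW_mono fle) gK.
have gf z w : (w < g z) = (f w < z) by rewrite -(leW_mono fle) gK.
apply/cvgrPdist_lt => e e0; near=> y.
rewrite ltr_norml; apply/andP; split.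
  rewrite ltrNl opprB ltrBlDr -gf; near: y; apply: lt_nbhsl.
  by rewrite gf; lra.
rewrite ltrBlDr -ltrBlDl -fg; near: y; apply: lt_nbhsr.
by rewrite fg; lra.
Unshelve. all: by end_near. Qed.

Section denjoy.
Variables (R : realType) (a : R).
Implicit Types (s t x y th : R).

(** Numbers that encode no integer are sent to 0; a repetition only enlarges a jump. *)
Definition enum_int (m : nat) : int := odflt 0 (unpickle m).

Lemma enum_int_surj n : exists m, enum_int m = n.
Proof. by exists (pickle n); rewrite /enum_int pickleK. Qed.

(* The right and left limits at t of the same increasing function, which has a
   jump at each n a + k and slope 1/2 elsewhere; the gaps of its range are the
   wandering intervals of the Denjoy homeomorphism. *)
Definition gap_right (b : R) t : R :=
  t - wsum (fun m => fracpart (t - (enum_int m)%:~R * b)).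
Definition gap_left t : R := - gap_right (- a) (- t) - 2^-1.

Definition on_orbit t := exists n k : int, t = n%:~R * a + k%:~R.

Let gap_fracN t : (fun m => fracpart (- t - (enum_int m)%:~R * - a)) =
  (fun m => fracpart (- (t - (enum_int m)%:~R * a))).
Proof. by apply/funext => m; congr fracpart; ring. Qed.

Let frac_le1 s : `|fracpart s| <= 1.
Proof. by have /andP[f0 f1] := frac_itv s; rewrite ger0_norm // ltW. Qed.
Hint Resolve frac_le1 : core.

Let lfrac_le1 s : `|1 - fracpart s| <= 1.
Proof. by have /andP[f0 f1] := frac_itv s; rewrite ger0_norm; lra. Qed.
Hint Resolve lfrac_le1 : core.

(** Changing the signs of [t] and [a] exchanges one-sided limits; the constant 1/2 in [gap_left] is
    the total weight. *)
Lemma gap_leftE t :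
  gap_left t = t - wsum (fun m => 1 - fracpart (- (t - (enum_int m)%:~R * a))).
Proof.
have one1 (m : nat) : `|1| <= 1 :> R by rewrite normr1.
rewrite /gap_left /gap_right gap_fracN (wsumB one1) //.
by rewrite wsum_cst; field.
Qed.

Lemma gap_right_bounds b t : t - 2^-1 <= gap_right b t <= t.
Proof.
rewrite /gap_right; set u := fun m => _.
have u1 : forall m, `|u m| <= 1 by move=> m; exact: frac_le1.
have : wsum (fun=> 0) <= wsum u.
  apply: le_wsum => // m; first by rewrite normr0.
  by have /andP[] := frac_itv (t - (enum_int m)%:~R * b).
have : wsum u <= wsum (fun=> 1).
  apply: le_wsum => // m; first by rewrite normr1.
  by have /andP[_ /ltW] := frac_itv (t - (enum_int m)%:~R * b).
by rewrite !wsum_cst; lra.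
Qed.

Lemma gap_left_bounds t : t - 2^-1 <= gap_left t <= t.
Proof. by have := gap_right_bounds (- a) (- t); rewrite /gap_left; lra. Qed.

Lemma gap_rightDz b t (k : int) :
  gap_right b (t + k%:~R) = gap_right b t + k%:~R.
Proof.
rewrite /gap_right addrAC; congr (_ - wsum _ + _); apply/funext => m.
by rewrite addrAC fracDz.
Qed.

Lemma gap_leftDz t (k : int) : gap_left (t + k%:~R) = gap_left t + k%:~R.
Proof. by rewrite /gap_left (opprD t) -mulrNz gap_rightDz mulrNz; ring. Qed.

(** Each summand grows by at most [t' - t] and the weights add up to 1/2, so the subtracted sum
    cannot absorb the growth of [t]. *)
Lemma gap_lt t t' : t < t' -> gap_right a t < gap_left t'.
Proof.
move=> tt'; rewrite gap_leftE /gap_right.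
pose c := Num.min 1 (t' - t).
have c0 : 0 < c by rewrite lt_min ltr01 subr_gt0.
set u := fun m => _; set u' := fun m => _.
have u1 : forall m, `|u m| <= 1 by move=> m; exact: frac_le1.
have u'1 : forall m, `|u' m| <= 1 by move=> m; exact: lfrac_le1.
have uc m : u' m - u m <= c.
  rewrite le_min; apply/andP; split.
    have := frac_itv (t - (enum_int m)%:~R * a).
    have := frac_itv (- (t' - (enum_int m)%:~R * a)).
    by rewrite /u' /u; lra.
  apply: le_trans (lfracB _) _; first by rewrite ltrD2r.
  by rewrite opprD addrACA subrr addr0.
have : wsum (fun m => u' m - u m) <= wsum (fun=> c).
  apply: le_wsum => // m.
    rewrite ler_norml (le_trans (uc m)) ?ge_min ?lexx // andbT.
    have := frac_itv (t - (enum_int m)%:~R * a).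
    have := frac_itv (- (t' - (enum_int m)%:~R * a)).
    by rewrite /u' /u; lra.
  by rewrite ger0_norm ?ge_min ?lexx // ltW.
have ct : c <= t' - t by rewrite ge_min lexx orbT.
rewrite wsumB // wsum_cst; lra.
Qed.

Lemma gap_le t : gap_left t <= gap_right a t.
Proof.
rewrite gap_leftE /gap_right lerD2l lerN2; apply: le_wsum => // m.
by rewrite -subr_ge0 lfrac_frac ler0n.
Qed.

Let gap_widthE t : gap_right a t - gap_left t =
  wsum (fun m => ((t - (enum_int m)%:~R * a) \is a Num.int)%:R).
Proof.
have -> : (fun m => ((t - (enum_int m)%:~R * a) \is a Num.int)%:R) =
    (fun m => (1 - fracpart (- (t - (enum_int m)%:~R * a))) -
              fracpart (t - (enum_int m)%:~R * a)).
  by apply/funext => m; rewrite lfrac_frac.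
by rewrite wsumB // gap_leftE /gap_right; lra.
Qed.

Lemma gap_lt_orbit t : on_orbit t -> gap_left t < gap_right a t.
Proof.
move=> [n [k tE]]; rewrite -subr_gt0 gap_widthE.
have [m mn] := enum_int_surj n.
apply: lt_le_trans (wsum_ge_term m _); last first.
  by move=> ?; rewrite ler0n lern1 leq_b1.
rewrite mn tE addrAC subrr add0r intr_int mulr1.
by rewrite mulr_gt0 ?exprn_gt0 ?invr_gt0.
Qed.

Lemma gap_eq t : ~ on_orbit t -> gap_left t = gap_right a t.
Proof.
move=> tN; apply/esym/eqP; rewrite -subr_eq0 gap_widthE.
have -> : (fun m => ((t - (enum_int m)%:~R * a) \is a Num.int)%:R) = (fun=> 0 : R).
  apply/funext => m; case: (boolP (_ \is a _)) => // /intrP[k kE].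
  by case: tN; exists (enum_int m), k; rewrite -kE; ring.
by rewrite wsum_cst mul0r.
Qed.

(** The first [M] floors are constant on a short interval to the right of [t], and all other jumps
    together weigh at most [2^-1 ^+ M]. *)
Lemma gap_right_cont b t (e : R) : 0 < e -> exists2 d : R, 0 < d &
  forall t', t <= t' < t + d -> gap_right b t' < gap_right b t + e.
Proof.
move=> e0.
have [M Me] : exists M : nat, 2^-1 ^+ M < e / 2.
  exists (Num.truncn (2 / e)).+1.
  rewrite exprVn -[ltRHS]invrK ltf_pV2 ?posrE ?exprn_gt0 ?invr_gt0 ?divr_gt0 //.
  rewrite invfM invrK mulrC; apply: lt_trans (truncnS_gt _) _.
  by rewrite -natrX ltr_nat ltn_expl.
have [d d0 dP] : exists2 d : R, 0 < d & forall m t', (m < M)%N ->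
    t <= t' < t + d -> Num.floor (t' - (enum_int m)%:~R * b) =
                       Num.floor (t - (enum_int m)%:~R * b).
  elim: (M) => [|M' [d d0 IH]]; first by exists 1.
  set s := t - (enum_int M')%:~R * b.
  exists (Num.min d ((Num.floor s)%:~R + 1 - s)).
    by rewrite lt_min d0 subr_gt0 -intrD1; have /andP[] := floor_itv s.
  move=> m t'; rewrite ltnS leq_eqVlt => mM /andP[tt'].
  rewrite addrC -ltrBlDr lt_min => /andP[t1 t2].
  case/predU1P: mM => [->|mM]; last by apply: IH => //; rewrite tt' addrC -ltrBlDr.
  apply: floor_def; rewrite intrD1.
  have /andP[s1 _] := floor_itv s; move: s1 t2; rewrite -/s.
  by move: (Num.floor s)%:~R => f; rewrite /s; lra.
(* A step shorter than 1 makes each floor jump by at most 1, as [wsum_tail] requires. *)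
exists (Num.min d (Num.min (e / 2) 1)).
  by rewrite !lt_min d0 ltr01 divr_gt0.
move=> t' /andP[tt']; rewrite addrC -ltrBlDr !lt_min => /and3P[t1 t2 t3].
pose J m : R := (Num.floor (t' - (enum_int m)%:~R * b))%:~R -
  (Num.floor (t - (enum_int m)%:~R * b))%:~R.
have J0 m : 0 <= J m by rewrite subr_ge0 ler_int le_floor // lerD2r.
have J1 m : J m <= 1.
  rewrite /J lerBlDl addrC -intrD1 ler_int -ltzD1.
  rewrite floor_lt_int intrD1.
  have /andP[_] := floor_itv (t - (enum_int m)%:~R * b); rewrite !intrD1; lra.
have JM : wsum J <= 2^-1 ^+ M.
  apply: wsum_tail => m; first by rewrite J0 J1.
  move=> mM; rewrite /J (dP m t') ?subrr // tt' /=; lra.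
have : wsum (fun m => fracpart (t - (enum_int m)%:~R * b) -
    fracpart (t' - (enum_int m)%:~R * b)) <= wsum J.
  apply: le_wsum => m.
  - have := frac_itv (t - (enum_int m)%:~R * b).
    by have := frac_itv (t' - (enum_int m)%:~R * b); rewrite ler_norml; lra.
  - by rewrite ger0_norm.
  - by rewrite /fracpart /J; lra.
rewrite wsumB // /gap_right; lra.
Qed.

(** Coordinates on the line: [t] selects a gap, and [th] in [0, 1] is the height in it. Off the
    orbit the gap is a single point. *)
Definition gap_point t th := gap_left t + th * (gap_right a t - gap_left t).

Lemma gap_point0 t : gap_point t 0 = gap_left t.
Proof. by rewrite /gap_point mul0r addr0. Qed.

Lemma gap_point1 t : gap_point t 1 = gap_right a t.
Proof. by rewrite /gap_point mul1r addrC subrK. Qed.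

Lemma gap_point_itv t th : 0 <= th <= 1 ->
  gap_left t <= gap_point t th <= gap_right a t.
Proof. by have := gap_le t; rewrite /gap_point; nra. Qed.

Lemma gap_pointDz t th (k : int) :
  gap_point (t + k%:~R) th = gap_point t th + k%:~R.
Proof. by rewrite /gap_point gap_leftDz gap_rightDz; ring. Qed.

Lemma gap_point_bounds t th : 0 <= th <= 1 -> `|gap_point t th - t| <= 2^-1.
Proof.
move/(@gap_point_itv t); have := gap_left_bounds t.
by have := gap_right_bounds a t; rewrite ler_norml; lra.
Qed.

Lemma gap_point_lt t t' th th' : 0 <= th <= 1 -> 0 <= th' <= 1 -> t < t' ->
  gap_point t th < gap_point t' th'.
Proof.
move=> /(@gap_point_itv t) + /(@gap_point_itv t') + /gap_lt.
by lra.
Qed.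

Lemma gap_point_lt_height t th th' : on_orbit t ->
  (gap_point t th < gap_point t th') = (th < th').
Proof.
by move/gap_lt_orbit => tO; rewrite ltrD2l ltr_pM2r // subr_gt0.
Qed.

Lemma gap_point_off t th th' : ~ on_orbit t -> gap_point t th = gap_point t th'.
Proof. by move=> /gap_eq e; rewrite /gap_point e subrr !mulr0. Qed.

Lemma gap_point_inj t t' th th' : 0 <= th <= 1 -> 0 <= th' <= 1 ->
  gap_point t th = gap_point t' th' -> t = t'.
Proof.
move=> h h' e; case: (ltgtP t t') => // tt'.
  by have := gap_point_lt h h' tt'; rewrite e ltxx.
by have := gap_point_lt h' h tt'; rewrite e ltxx.
Qed.

Lemma gap_point_inj_height t th th' : on_orbit t ->
  gap_point t th = gap_point t th' -> th = th'.
Proof.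
by move=> tO e; case: (ltgtP th th') => //; rewrite -(gap_point_lt_height _ _ tO) e ltxx.
Qed.

(** The gap of [x] sits at the supremum of the [t] with [gap_left t <= x]. Left-continuity of
    [gap_left], obtained by reflection, puts its left end below [x]; right-continuity of [gap_right]
    puts its right end above. *)
Lemma gap_point_surj x : exists p : R * R,
  0 <= p.2 <= 1 /\ gap_point p.1 p.2 = x.
Proof.
pose E := [set t | gap_left t <= x].
have Esup : has_sup E.
  split; first by exists x; rewrite /E /=; have /andP[] := gap_left_bounds x.
  by exists (x + 2^-1) => t; rewrite /E /= => tx; have := gap_left_bounds t; lra.
set t := sup E.
have tx : gap_left t <= x.
  rewrite leNgt; apply/negP => xt.
  have [d d0 dP] := @gap_right_cont (- a) (- t) (gap_left t - x) ltac:(lra).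
  have [t' Et' tt'] := sup_adherent d0 Esup.
  have t't : t' <= t by exact: ub_le_sup Esup.2 _ Et'.
  have := dP (- t') ltac:(rewrite -/t in tt' *; lra).
  by move: Et'; rewrite /E /= /gap_left; lra.
have xt : x <= gap_right a t.
  rewrite leNgt; apply/negP => xt.
  have [d d0 dP] := @gap_right_cont a t (x - gap_right a t) ltac:(lra).
  have lt := dP (t + d / 2) ltac:(lra).
  have : E (t + d / 2) by rewrite /E /=; have := gap_le (t + d / 2); lra.
  by move/(ub_le_sup Esup.2); rewrite -/t; lra.
have [tO|tO] := pselect (on_orbit t); last first.
  exists (t, 0); rewrite gap_point0 /= lexx ler01; split=> //.
  by apply/eqP; rewrite eq_le tx (gap_eq tO).
have w0 := gap_lt_orbit tO.
exists (t, (x - gap_left t) / (gap_right a t - gap_left t)) => /=; split.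
  by rewrite divr_ge0 ?subr_ge0 ?(ltW w0) //= ler_pdivrMr ?subr_gt0 // mul1r lerD2r.
by rewrite /gap_point divfK ?subr_eq0 ?gt_eqF // addrC subrK.
Qed.

Definition gap_coord x : R * R := sval (cid (gap_point_surj x)).

(* Denjoy's homeomorphism is [denjoy 1], its inverse is [denjoy (- 1)]. *)
Definition denjoy (n : int) x : R :=
  gap_point ((gap_coord x).1 + n%:~R * a) (gap_coord x).2.

Let orbitD t (n : int) : on_orbit (t + n%:~R * a) <-> on_orbit t.
Proof.
split=> -[m [k tE]].
  by exists (m - n), k; rewrite intrB; move: tE; lra.
by exists (m + n), k; rewrite tE intrD; ring.
Qed.

(** The chosen coordinates can differ from [t] and [th] only in the height over a one-point gap, and
    the gap at [t + n%:~R * a] is then a point too. *)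
Lemma denjoy_gap_point n t th : 0 <= th <= 1 ->
  denjoy n (gap_point t th) = gap_point (t + n%:~R * a) th.
Proof.
move=> h; rewrite /denjoy /gap_coord; case: cid => -[t' th'] /= [h' e].
have et := gap_point_inj h' h e; rewrite et in e *.
have [tO|tO] := pselect (on_orbit t); first by rewrite (gap_point_inj_height tO e).
by apply: gap_point_off; rewrite orbitD.
Qed.

Lemma denjoyK n m : n + m = 0 -> cancel (denjoy n) (denjoy m).
Proof.
move=> nm x; have [[t th] [h /= <-]] := gap_point_surj x.
by rewrite !denjoy_gap_point // -addrA -mulrDl -intrD nm mul0r addr0.
Qed.

Lemma denjoyDz n x (k : int) : denjoy n (x + k%:~R) = denjoy n x + k%:~R.
Proof.
have [[t th] [h /= <-]] := gap_point_surj x.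
by rewrite -gap_pointDz !denjoy_gap_point // addrAC gap_pointDz.
Qed.

Lemma denjoy_increasing n : {homo denjoy n : x y / x < y}.
Proof.
move=> x y; have [[t th] [h /= <-]] := gap_point_surj x.
have [[t' th'] [h' /= <-]] := gap_point_surj y.
rewrite !denjoy_gap_point //.
have [tt'|t't|tt'] := ltgtP t t'.
- by move=> _; apply: gap_point_lt; rewrite ?ltrD2r.
- by rewrite ltNge => /negP[]; apply/ltW/gap_point_lt.
rewrite -tt'; have [tO|tO] := pselect (on_orbit t).
  by rewrite !gap_point_lt_height // orbitD.
by rewrite (gap_point_off th th' tO) ltxx.
Qed.

Lemma denjoy_continuous n : continuous (denjoy n).
Proof.
apply: (increasing_surjective_continuous (@denjoy_increasing n)).
by apply: (@denjoyK (- n)); rewrite addNr.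
Qed.

End denjoy.

(** * Maps of the torus *)

Section row_vectors.
Variables (R : realType) (d : nat).
Implicit Types v : 'rV[R]_d.

Lemma row_norm_le v (e : R) : 0 <= e ->
  (forall j, `|v ord0 j| <= e) -> `|v| <= e.
Proof.
move=> e0 ve; rewrite -[`|v|]/(mx_norm v) mx_normrE.
by apply: bigmax_le => // -[i j] _ /=; rewrite (ord1 i).
Qed.

Lemma row_norm_lt v (e : R) : 0 < e ->
  (forall j, `|v ord0 j| < e) -> `|v| < e.
Proof.
move=> e0 ve; rewrite -[`|v|]/(mx_norm v) mx_normrE.
by apply: bigmax_lt => // -[i j] _ /=; rewrite (ord1 i).
Qed.

Lemma row_coord_le_norm v j : `|v ord0 j| <= `|v|.
Proof.
rewrite -[`|v|]/(mx_norm v) mx_normrE.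
exact: (le_bigmax _ (fun i : 'I_1 * 'I_d => `|v i.1 i.2|) (ord0, j)).
Qed.

Lemma row_continuous (T : topologicalType) (F : T -> 'rV[R]_d) :
  (forall j, continuous (fun x => F x ord0 j)) -> continuous F.
Proof.
move=> cF x; apply/cvgrPdist_lt => e e0.
have : \forall y \near x, forall j, `|F x ord0 j - F y ord0 j| < e.
  by apply: filter_forall => j; move/cvgrPdist_lt: (cF j x); apply.
by apply: filterS => y Fy; apply: row_norm_lt => // j; rewrite !mxE.
Qed.

End row_vectors.

Section torus_topology.
Variables (R : realType) (d : nat).
Local Notation pi := (@torus_pi R d).
Implicit Types (F : 'rV[R]_d -> 'rV[R]_d) (z k : 'rV[R]_d).

Definition integer_vector k := forall j, k ord0 j \is a Num.int.

Lemma torus_pi_eq z z' : pi z = pi z' <-> integer_vector (z - z').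
Proof. exact: torus_piE. Qed.

Lemma torus_pi_continuous : continuous pi.
Proof. exact: pi_continuous. Qed.

(** The saturation of an open set is a union of its integer translates, hence open. *)
Lemma torus_pi_open z (A : set 'rV[R]_d) : nbhs z A -> nbhs (pi z) (pi @` A).
Proof.
rewrite nbhsE => -[B [oB Bz] BA].
rewrite nbhsE; exists (pi @` B); last exact: image_subset.
split; last by exists z.
rewrite /open /= /quotient_open openE => y /= [x Bx xy].
have Bxn : nbhs x B by apply: open_nbhs_nbhs.
have := nbhsB (y - x) Bxn; rewrite subrK => yB.
apply: filterS yB => _ /= [w Bw <-]; exists w => //.
by apply/torus_pi_eq; rewrite opprD addrCA subrr addr0 opprB; apply/torus_pi_eq.
Qed.

Definition descend F (p : torus R d) : torus R d := pi (F (repr p)).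

Definition equivariant F := forall z k, integer_vector k -> F (z + k) = F z + k.

Lemma descendE F : equivariant F -> forall z, descend F (pi z) = pi (F z).
Proof.
move=> eF z; have /torus_pi_eq rz : pi (repr (pi z)) = pi z by exact: reprK.
rewrite /descend -{1}[repr _](subrK z) addrC eF //.
by apply/torus_pi_eq; rewrite addrAC subrr add0r.
Qed.

Lemma descend_continuous F : equivariant F -> continuous F ->
  continuous (descend F).
Proof.
move=> eF cF; apply/quotient_continuous; rewrite -/pi.
have -> : descend F \o pi = pi \o F by apply/funext => z; exact: descendE.
by move=> z; apply: continuous_comp; [exact: cF | exact: torus_pi_continuous].
Qed.

(** The segments from [F z] to [z] give a homotopy to the identity, because [z - F z] is invariant
    under integer translations. Its joint continuity descends because [torus_pi] is open. *)
Lemma descend_homeo0 F G : equivariant F -> equivariant G ->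
  continuous F -> continuous G -> cancel F G -> cancel G F ->
  Homeo0 (descend F).
Proof.
move=> eF eG cF cG FK GK; split.
  split; first exact: descend_continuous.
  exists (descend G); split; first exact: descend_continuous.
    by move=> p; have [z <-] := torus_pi_surj p; rewrite !descendE // FK.
  by move=> p; have [z <-] := torus_pi_surj p; rewrite !descendE // GK.
pose K (s : R) z := F z + s *: (z - F z).
have eK s : equivariant (K s).
  move=> z k ik; rewrite /K eF // opprD addrACA subrr addr0 addrAC //.
exists (fun x => descend (K x.1) x.2); split.
- apply: continuous_subspaceT => -[s p] /=.
  have [z <-] := torus_pi_surj p => U /=.
  rewrite descendE // => /torus_pi_continuous KU.
  have cK : continuous (fun x : R * 'rV[R]_d => K x.1 x.2).
    move=> x; have cF2 : F y.2 @[y --> x] --> F x.2.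
      by apply: (continuous_comp _ (cF _)); exact: cvg_snd.
    apply: cvgD => //; apply: cvgZ; first exact: cvg_fst.
    by apply: cvgB => //; exact: cvg_snd.
  have [[A B] /= [nA nB] AB] := cK (s, z) _ KU.
  exists (A, pi @` B) => /=; first by split=> //; exact: torus_pi_open.
  move=> [s' p'] /= [As' [z' Bz' <-]]; rewrite descendE //.
  exact: (AB (s', z')).
- by move=> p; rewrite /descend /K scale0r addr0.
- by move=> p; rewrite /descend /K scale1r addrC subrK /torus_pi reprK.
Qed.

(** [repr] need not be continuous, so a coordinate of [psi] read on representatives is controlled
    only up to integers. *)
Lemma torus_map_coord_near (psi : torus R d -> torus R d) (j : 'I_d) z (e : R) :
  continuous psi -> 0 < e -> \forall z' \near z, exists k : int,
    `|repr (psi (pi z')) ord0 j - repr (psi (pi z)) ord0 j - k%:~R| < e.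
Proof.
move=> cpsi e0; set w := repr (psi (pi z)).
have nw : nbhs (psi (pi z)) (pi @` ball w e).
  by rewrite -[psi _]reprK; apply: torus_pi_open; exact: nbhsx_ballx.
have near_w : \forall z' \near z, (pi @` ball w e) (psi (pi z')).
  exact: (continuous_comp (@torus_pi_continuous z) (cpsi (pi z)) nw).
apply: filterS near_w => z' /= [w' bw' w'E].
have /torus_pi_eq/(_ j) : pi (repr (psi (pi z'))) = pi w'.
  by rewrite w'E; exact: reprK.
rewrite !mxE => /intrP[k kE]; exists k.
rewrite -kE.
have -> (x y w0 : R) : x - w0 - (x - y) = y - w0 by ring.
have -> : w' ord0 j - w ord0 j = (w' - w) ord0 j by rewrite !mxE.
apply: le_lt_trans (row_coord_le_norm _ _) _.
by move: bw'; rewrite -ball_normE /ball_ /= distrC.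
Qed.

End torus_topology.

(** * The skew product *)

Lemma dist_int_continuous (R : realType) : continuous (@dist_int R).
Proof.
move=> x; apply/cvgrPdist_lt => e e0.
apply: filterS (nbhsx_ballx x e e0) => y; rewrite -ball_normE /ball_ /=.
apply: le_lt_trans; rewrite ler_norml.
by have := dist_int_lip x y; have := dist_int_lip y x; rewrite (distrC y); lra.
Qed.

Lemma bounded_rotation_set (R : realType) (d : nat)
    (F : 'rV[R]_d -> 'rV[R]_d) (rho : 'rV[R]_d) :
  bounded_mean_motion F rho -> rotation_set F = [set rho].
Proof.
move=> [M bM].
have M0 : 0 <= M by apply: le_trans (bM 0%N 0); exact: normr_ge0.
have lim (n_ : nat -> nat) z_ : n_ @ \oo --> \oo ->
    (n_ i)%:R^-1 *: (iter (n_ i) F (z_ i) - z_ i) @[i --> \oo] --> rho.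
  move=> ninf; apply/cvgrPdist_lt => e e0.
  pose N := (Num.truncn (M / e)).+1.
  have : \forall i \near \oo, (N <= n_ i)%N by exact: (ninf _ (nbhs_infty_ge N)).
  apply: filterS => i Ni.
  have ni0 : 0 < (n_ i)%:R :> R by rewrite ltr0n; apply: leq_trans Ni.
  rewrite distrC -[X in _ - X](scalerK (lt0r_neq0 ni0)) -scalerBr normrZ normfV.
  rewrite (gtr0_norm ni0) ltr_pdivrMl //; apply: le_lt_trans (bM _ _) _.
  rewrite mulrC -ltr_pdivrMl // mulrC; apply: lt_le_trans (truncnS_gt _) _.
  by rewrite ler_nat.
apply/seteqP; split=> [r [n_ [z_ [_ ninf cr]]]|r ->].
  exact: (cvg_unique _ cr (lim _ _ ninf)).
exists id, (fun=> 0); split=> //; exact: lim.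
Qed.

Section skew_product.
Variables (R : realType) (d : nat) (rho : 'rV[R]_d.+2).
Local Notation a := (rho ord0 ord0).
Hypothesis irr_a : incommensurable a.
Local Notation N := (d.+2%:R : R).
Local Notation gp := (gap_point a).
Implicit Types (x t th s : R) (y z : 'rV[R]_d.+2) (i j : 'I_d.+2).

Let width : R := gap_right a 0 - gap_left a 0.

Let on_orbit_int (k : int) : on_orbit a k%:~R.
Proof. by exists 0, k; rewrite mul0r add0r. Qed.

Let width_gt0 : 0 < width.
Proof. by rewrite subr_gt0; apply: gap_lt_orbit; exact: (on_orbit_int 0). Qed.

Let width_lt1 : width < 1.
Proof.
have := gap_lt a (@ltr01 R); rewrite -[X in gap_left _ X]add0r.
by rewrite -[X in 0 + X]/(1%:~R) gap_leftDz /width; lra.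
Qed.

Let N_gt0 : 0 < N.
Proof. by rewrite ltr0n. Qed.

(* The tents for distinct j have disjoint supports inside the gap at 0 (modulo
   the integers), so that the vector of tents runs along the axes. *)
Definition tent j x : R := Num.max 0 (1 - 2 * N / width *
  dist_int (x - (gap_left a 0 + width * (2 * j%:R + 1) / (2 * N)))).

Let slope_gt0 : 0 < 2 * N / width.
Proof. by rewrite divr_gt0 // mulr_gt0. Qed.

Lemma tent_itv j x : 0 <= tent j x <= 1.
Proof.
rewrite /tent le_max lexx /= ge_max ler01 /= gerBl.
by rewrite mulr_ge0 ?dist_int_ge0 // ltW.
Qed.

Lemma tent_continuous j : continuous (tent j).
Proof.
pose g x := 1 - 2 * N / width *
  dist_int (x - (gap_left a 0 + width * (2 * j%:R + 1) / (2 * N))).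
have cg : continuous g.
  move=> x; apply: cvgB; first exact: cvg_cst.
  apply: cvgM; first exact: cvg_cst.
  apply: (@continuous_comp _ _ _ (fun x => x - _) (@dist_int R)).
    by apply: cvgB; [exact: cvg_id | exact: cvg_cst].
  exact: dist_int_continuous.
have -> : tent j = cst 0 \max g by [].
by move=> x; apply: continuous_max (cg x); exact: cvg_cst.
Qed.

Lemma tentDz j x (k : int) : tent j (x + k%:~R) = tent j x.
Proof. by rewrite /tent addrAC dist_intDz. Qed.

(** In terms of the height, tent [j] is centred at [(2 * j + 1) / (2 * N)] with half-width
    [1 / (2 * N)]. *)
Lemma tent_support j x : tent j x != 0 -> exists (k : int) th,
  [/\ 0 <= th <= 1, 2 * j%:R < 2 * N * th < 2 * j%:R + 2 & x = gp k%:~R th].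
Proof.
move=> b0; have : 0 < tent j x by rewrite lt_def b0; have /andP[] := tent_itv j x.
rewrite /tent lt_max ltxx /= subr_gt0; set m := gap_left a 0 + _.
have [k ->] := dist_intP (x - m).
rewrite -(gtr0_norm slope_gt0) -normrM.
pose th := (x - k%:~R - gap_left a 0) / width.
have -> : 2 * N / width * (x - m - k%:~R) = 2 * N * th - (2 * j%:R + 1).
  by rewrite /m /th; field; rewrite !gt_eqF.
rewrite ltr_norml => jth.
have jN : j%:R + 1 <= N by rewrite natr1 ler_nat.
have j0 : 0 <= j%:R :> R by rewrite ler0n.
exists k, th; split; [ | lra | ].
  by apply/andP; split; nra.
rewrite -[k%:~R]add0r gap_pointDz /gap_point -/width /th divfK ?gt_eqF //.
by ring.
Qed.

Lemma tent_support_gap j t th : 0 <= th <= 1 -> tent j (gp t th) != 0 ->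
  (exists k : int, t = k%:~R) /\ 2 * j%:R < 2 * N * th < 2 * j%:R + 2.
Proof.
move=> h /tent_support[k [th' [h' jth' e]]].
have tk := gap_point_inj h h' e; split; first by exists k.
by rewrite tk in e; rewrite (gap_point_inj_height (on_orbit_int k) e).
Qed.

(** Every support ends at height 1 at the latest. The right end of the gap is thus never translated
    and serves as a reference orbit. *)
Lemma tent_gap_right j t : tent j (gp t 1) = 0.
Proof.
apply/eqP/negPn/negP => /tent_support_gap[|_ jN]; first by rewrite ler01 lexx.
have : j%:R + 1 <= N by rewrite natr1 ler_nat.
by move: jN; lra.
Qed.

(** Heights on the rising half of tent [j], indexed by the value [s] of the tent there. *)
Let tent_height j s : R := (2 * j%:R + s) / (2 * N).

Let tent_height_itv j s : 0 <= s <= 1 -> 0 <= tent_height j s <= 1.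
Proof.
move=> h; rewrite divr_ge0 /=; last by rewrite mulr_ge0.
  rewrite ler_pdivrMr ?mulr_gt0 //.
  by have : j%:R + 1 <= N by [rewrite natr1 ler_nat]; lra.
by have : 0 <= j%:R :> R by [rewrite ler0n]; lra.
Qed.

Lemma tent_value i j s : 0 <= s <= 1 ->
  tent i (gp 0 (tent_height j s)) = if i == j then s else 0.
Proof.
move=> h; have [->|ij] := eqVneq i j.
  rewrite /tent /gap_point -/width /tent_height.
  have -> : gap_left a 0 + (2 * j%:R + s) / (2 * N) * width -
     (gap_left a 0 + width * (2 * j%:R + 1) / (2 * N)) =
     - (width * (1 - s) / (2 * N)) by field; rewrite gt_eqF.
  have x0 : 0 <= width * (1 - s) / (2 * N).
    by rewrite divr_ge0 ?mulr_ge0 ?(ltW width_gt0) //; lra.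
  rewrite dist_intN dist_int_small ger0_norm //; last first.
    have : N >= 1 by rewrite ler1n.
    have : width * (1 - s) <= 1.
      apply: mulr_ile1; rewrite ?(ltW width_gt0) ?(ltW width_lt1) //; lra.
    by rewrite ler_pdivrMr ?mulr_gt0 // => ws N1; rewrite mulKf // (le_trans ws).
  have -> : 2 * N / width * (width * (1 - s) / (2 * N)) = 1 - s.
    by field; rewrite !gt_eqF.
  by rewrite subKr; apply/max_idPr; lra.
apply/eqP/negPn/negP => /tent_support_gap[|_]; first exact: tent_height_itv.
rewrite /tent_height [2 * N * _]mulrC divfK ?gt_eqF ?mulr_gt0 // => /andP[lo hi].
case/negP: ij; apply/eqP/val_inj => /=; apply/eqP; rewrite eqn_leq.
have lo' : (i%:R : R) < j%:R + 1 by lra.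
have hi' : (j%:R : R) < i%:R + 1 by lra.
by move: lo' hi'; rewrite !natr1 !ltr_nat !ltnS => -> ->.
Qed.

(** [y] is a full vector with entry 0 overwritten, so that [rho] and the tents can be added without
    cutting off their first entry. *)
Definition pt x y : 'rV[R]_d.+2 := \row_j if j == ord0 then x else y ord0 j.
Definition tents x : 'rV[R]_d.+2 := \row_j tent j x.

Definition skew_map z := pt (denjoy a 1 (z ord0 ord0)) (z + rho + tents (z ord0 ord0)).
(** The translation to be undone was made over the preimage [x], so the tents are evaluated
    there. *)
Definition skew_inv z :=
  let x := denjoy a (- 1) (z ord0 ord0) in pt x (z - rho - tents x).

Lemma pt0 x y : pt x y ord0 ord0 = x.
Proof. by rewrite mxE eqxx. Qed.

Lemma pt_coord z : pt (z ord0 ord0) z = z.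
Proof. by apply/rowP => j; rewrite mxE; case: eqP => // ->. Qed.

Lemma pt_ptD x x' y v : pt x (pt x' y + v) = pt x (y + v).
Proof. by apply/rowP => j; rewrite !mxE; case: eqP. Qed.

Lemma ptDz x y (k : int) : pt (x + k%:~R) y = pt x y + k%:~R *: delta_mx ord0 ord0.
Proof.
by apply/rowP => j; rewrite !mxE eqxx /=; case: eqP => _; rewrite ?mulr1 // mulr0 addr0.
Qed.

Lemma skewK : cancel skew_map skew_inv.
Proof.
move=> z; apply/rowP => j; rewrite /skew_inv /skew_map pt0 denjoyK ?subrr // !mxE.
by case: eqP => [-> //|_]; ring.
Qed.

Lemma skew_invK : cancel skew_inv skew_map.
Proof.
move=> z; apply/rowP => j; rewrite /skew_inv /skew_map pt0 denjoyK ?addNr // !mxE.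
by case: eqP => [-> //|_]; ring.
Qed.

Lemma denjoy_equivariant n x c : c \is a Num.int ->
  denjoy a n (x + c) = denjoy a n x + c.
Proof. by move=> /intrP[k ->]; rewrite denjoyDz. Qed.

Lemma tent_periodic j x c : c \is a Num.int -> tent j (x + c) = tent j x.
Proof. by move=> /intrP[k ->]; rewrite tentDz. Qed.

Lemma skew_equivariant : equivariant skew_map.
Proof.
move=> z k ik; apply/rowP => j; rewrite !mxE.
case: eqP => [->|_]; first by rewrite denjoy_equivariant.
by rewrite tent_periodic //; ring.
Qed.

Lemma skew_inv_equivariant : equivariant skew_inv.
Proof.
move=> z k ik; apply/rowP => j; rewrite !mxE.
case: eqP => [->|_]; first by rewrite denjoy_equivariant.
by rewrite denjoy_equivariant // tent_periodic //; ring.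
Qed.

Let coord_cvg j z : y ord0 j @[y --> z] --> z ord0 j.
Proof. exact: coord_continuous. Qed.

Let denjoy_cvg n z : denjoy a n (y ord0 ord0) @[y --> z] --> denjoy a n (z ord0 ord0).
Proof. exact: (continuous_comp (@coord_cvg ord0 z) (@denjoy_continuous _ a n _)). Qed.

Lemma skew_continuous : continuous skew_map.
Proof.
apply: row_continuous => j z; under eq_fun do rewrite !mxE.
case: eqP => _; first exact: denjoy_cvg.
apply: (@continuousD _ _ _ (fun y => y ord0 j + rho ord0 j)).
  apply: (@continuousD _ _ _ (fun y => y ord0 j) (cst (rho ord0 j))).
    exact: coord_cvg.
  exact: cst_continuous.
exact: (continuous_comp (@coord_cvg ord0 z) (@tent_continuous j _)).
Qed.

Lemma skew_inv_continuous : continuous skew_inv.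
Proof.
apply: row_continuous => j z; under eq_fun do rewrite !mxE.
case: eqP => _; first exact: denjoy_cvg.
apply: (@continuousB _ _ _ (fun y => y ord0 j - rho ord0 j)).
  apply: (@continuousB _ _ _ (fun y => y ord0 j) (cst (rho ord0 j))).
    exact: coord_cvg.
  exact: cst_continuous.
exact: (continuous_comp (@denjoy_cvg (-1) z) (@tent_continuous j _)).
Qed.

Lemma iter_skew (n : nat) t th y : 0 <= th <= 1 ->
  iter n skew_map (pt (gp t th) y) = pt (gp (t + n%:R * a) th)
    (y + n%:R *: rho + \sum_(i < n) tents (gp (t + i%:R * a) th)).
Proof.
move=> h; elim: n => [|n IH].
  by rewrite mul0r !addr0 scale0r big_ord0 !addr0.
rewrite iterS IH /skew_map pt0 denjoy_gap_point // -addrA -mulrDl natr1.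
rewrite -[pt _ _ + _ + _]addrA pt_ptD addrACA big_ord_recr /=.
by congr pt; rewrite -natr1 scalerDl scale1r (addrA y).
Qed.

(** The gap is wandering: tents live over the gaps at integers, and irrationality of [a] allows at
    most one integer among the [t + i%:R * a]. *)
Lemma tent_orbit_sum j (n : nat) t th : 0 <= th <= 1 ->
  0 <= \sum_(i < n) tent j (gp (t + i%:R * a) th) <= 1.
Proof.
move=> h; rewrite sumr_ge0 /=; last first.
  by move=> i _; have /andP[] := tent_itv j (gp (t + i%:R * a) th).
have [/existsP[i0 i0P]|/existsPn none] :=
    boolP [exists i : 'I_n, tent j (gp (t + i%:R * a) th) != 0].
  rewrite (bigD1 i0) //= big1 ?addr0.
    by have /andP[] := tent_itv j (gp (t + i0%:R * a) th).
  move=> i ii0; apply/eqP/negPn/negP => iP.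
  have [[k kE] _] := tent_support_gap h iP.
  have [[k' k'E] _] := tent_support_gap h i0P.
  have : (i%:Z - i0%:Z)%:~R * a + (k' - k)%:~R = 0.
    by rewrite !intrB -kE -k'E -!pmulrn; ring.
  move/(incommensurable_intmul irr_a)/eqP; rewrite subr_eq0 eqz_nat => /eqP e.
  by move: ii0; rewrite -val_eqE /= e eqxx.
by rewrite big1 // => i _; apply/eqP/negPn/none.
Qed.

Lemma skew_bounded : bounded_mean_motion skew_map rho.
Proof.
(* In the base, both end points are within 1/2 of their orbit parameters; in the fibre, each tent
   adds up to at most 1 along an orbit. *)
exists 1 => n z; rewrite -(pt_coord z).
have [[t th] [h /= <-]] := gap_point_surj a (z ord0 ord0).
rewrite iter_skew //; apply: row_norm_le => // j; rewrite !mxE summxE.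
case: eqP => [->|_].
  have := gap_point_bounds a (t + n%:R * a) h.
  by have := gap_point_bounds a t h; rewrite !ler_norml; lra.
under eq_bigr do rewrite mxE.
have := tent_orbit_sum j n t h; set S := \sum_(i < n) _ => S01.
have -> : z ord0 j + n%:R * rho ord0 j + S - z ord0 j - n%:R * rho ord0 j = S.
  by ring.
by rewrite ger0_norm; lra.
Qed.

(** * The obstruction to a semi-conjugacy *)

Section coboundary.
(** [l] stands for a coordinate of the semi-conjugacy read on representatives, [b] for that
    coordinate of the rotation vector; hence continuity and the functional equation hold modulo
    1. *)
Variables (l : 'rV[R]_d.+2 -> R) (b : R).
Hypothesis l_near : forall z (e : R), 0 < e ->
  \forall z' \near z, dist_int (l z' - l z) < e.
Hypothesis l_periodic : forall z k, integer_vector k -> l (z + k) = l z.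
Hypothesis l_skew : forall z, dist_int (l (skew_map z) - l z - b) = 0.

Let right_end := gap_right a 0.

Let dist_int0_le x t : dist_int x = 0 -> dist_int (x + t) <= dist_int t.
Proof. by move=> x0; apply: le_trans (dist_intD _ _) _; rewrite x0 add0r. Qed.

Lemma l_iter (n : nat) z : dist_int (l (iter n skew_map z) - l z - n%:R * b) = 0.
Proof.
elim: n => [|n IH]; first by rewrite subrr mul0r subr0 dist_int_int // rpred0.
apply/eqP; rewrite eq_le dist_int_ge0 andbT -[leRHS]IH iterS.
have -> : l (skew_map (iter n skew_map z)) - l z - n.+1%:R * b =
  (l (skew_map (iter n skew_map z)) - l (iter n skew_map z) - b) +
  (l (iter n skew_map z) - l z - n%:R * b) by rewrite -natr1; ring.
by apply: dist_int0_le; exact: l_skew.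
Qed.

Lemma l_ptDz x y (k : int) : l (pt (x + k%:~R) y) = l (pt x y).
Proof.
rewrite ptDz l_periodic // => j; rewrite !mxE.
by rewrite rpredM // ?intr_int // rpred_nat.
Qed.

(** Uniformity in [y] comes from compactness of the unit cube, and from periodicity outside it. *)
Lemma l_uniform (x0 e : R) : 0 < e -> exists2 del : R, 0 < del &
  forall x y, `|x - x0| < del -> dist_int (l (pt x y) - l (pt x0 y)) < e.
Proof.
move=> e0.
pose K := [set v : 'rV[R]_d.+2 | forall i, v ord0 i \in `[0, 1]].
have cK : compact K.
  apply: (@rV_compact _ _ (fun=> `[(0 : R), 1]%classic)) => i.
  exact: segment_compact.
have coord_fst j : continuous (fun q : 'rV[R]_d.+2 * R => q.1 ord0 j).
  move=> q; apply: (@continuous_comp _ _ _ fst (fun v : 'rV[R]_d.+2 => v ord0 j)).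
    exact: cvg_fst.
  exact: coord_continuous.
have cpt : continuous (fun q : 'rV[R]_d.+2 * R => pt q.2 q.1).
  apply: row_continuous => j q; under eq_fun do rewrite mxE.
  case: eqP => _; first exact: cvg_snd.
  exact: coord_fst.
have cpt0 : continuous (fun q : 'rV[R]_d.+2 * R => pt x0 q.1).
  apply: row_continuous => j q; under eq_fun do rewrite mxE.
  case: eqP => _; first exact: cst_continuous.
  exact: coord_fst.
have e20 : 0 < e / 2 by rewrite divr_gt0.
have := (compact_near_coveringP K).1 cK R (nbhs x0)
  (fun x y => dist_int (l (pt x y) - l (pt x0 y)) < e) _.
case=> [y0 Ky0|del /= del0 H].
  have H1 : \forall q \near (y0, x0),
      dist_int (l (pt q.2 q.1) - l (pt x0 y0)) < e / 2.
    exact: (cpt (y0, x0) _ (l_near (pt x0 y0) e20)).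
  have H2 : \forall q \near (y0, x0),
      dist_int (l (pt x0 q.1) - l (pt x0 y0)) < e / 2.
    exact: (cpt0 (y0, x0) _ (l_near (pt x0 y0) e20)).
  apply: filterS (filterI H1 H2) => -[y x] [/= lx lx0].
  have -> : l (pt x y) - l (pt x0 y) = (l (pt x y) - l (pt x0 y0)) +
    - (l (pt x0 y) - l (pt x0 y0)) by ring.
  by apply: le_lt_trans (dist_intD _ _) _; rewrite dist_intN; lra.
exists del => // x y xdel.
pose v : 'rV[R]_d.+2 := \row_j fracpart (y ord0 j).
have lv x' : l (pt x' y) = l (pt x' v).
  rewrite -[RHS](@l_periodic _ (pt 0 (y - v))).
    by congr l; apply/rowP => j; rewrite !mxE; case: eqP => _; ring.
  move=> j; rewrite !mxE; case: eqP => _; first exact: rpred0.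
  by rewrite /fracpart subKr intr_int.
rewrite !lv; apply: (H x); first by rewrite /= distrC.
by move=> j /=; rewrite mxE in_itv /=; have /andP[-> /ltW ->] := frac_itv (y ord0 j).
Qed.

(** By right-continuity of [gap_right] at 0, the gaps slightly to the right of 0 modulo 1 lie
    entirely in a short interval beyond [right_end]. *)
Lemma l_near_right (e : R) : 0 < e -> exists2 eta : R, 0 < eta &
  forall t (k : int) th y, 0 < t + k%:~R < eta -> 0 <= th <= 1 ->
    dist_int (l (pt (gp t th) y) - l (pt right_end y)) < e.
Proof.
move=> e0; have [del del0 H] := l_uniform right_end e0.
have [eta eta0 etaP] := gap_right_cont a 0 del0.
exists eta => // t k th y /andP[t0 t1] h.
rewrite -(l_ptDz _ _ k) -gap_pointDz; apply: H.
have /andP[_ g1] := gap_point_itv a (t + k%:~R) h.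
have g2 := etaP (t + k%:~R) ltac:(by rewrite add0r t1 ltW).
have /andP[g3 _] := gap_point_itv a (t + k%:~R) h.
have g4 := gap_lt a t0.
by rewrite ltr_norml /right_end; apply/andP; split; lra.
Qed.

Let h1 : (0 : R) <= (1 : R) <= 1.
Proof. by rewrite ler01 lexx. Qed.

Let tents_right t : tents (gp t 1) = 0.
Proof. by apply/rowP => j; rewrite !mxE tent_gap_right. Qed.

Let tents_orbit (n : int) th : 0 <= th <= 1 -> n != 0 ->
  tents (gp (n%:~R * a) th) = 0.
Proof.
move=> h n0; apply/rowP => j; rewrite !mxE; apply/eqP/negPn/negP.
move=> /(tent_support_gap h)[[k kE] _]; case/eqP: n0.
by apply: (@incommensurable_intmul _ a n (- k) irr_a); rewrite kE intrN subrr.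
Qed.

(** The orbit leaves the gap at 0 with its one translation by the tents and never meets an integer
    gap again. *)
Lemma l_forward (n : nat) th y : 0 <= th <= 1 ->
  dist_int (l (pt (gp (n.+1%:R * a) th) (y + tents (gp 0 th) + n.+1%:R *: rho))
            - l (pt (gp 0 th) y) - n.+1%:R * b) = 0.
Proof.
move=> h; rewrite -[RHS](l_iter n.+1 (pt (gp 0 th) y)) iter_skew // big_ord_recl.
rewrite big1 => [|i _]; last first.
  rewrite add0r; exact: (@tents_orbit i.+1%:Z).
by rewrite /= mul0r !add0r addr0 [y + _ + tents _]addrAC.
Qed.

(** Only the points before the arrival in the gap at 0 contribute tents, and none of them lies over
    an integer gap. *)
Lemma l_backward (n : nat) th y : 0 <= th <= 1 ->
  dist_int (l (pt (gp 0 th) y) -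
    l (pt (gp (- (n.+1%:R * a)) th) (y - n.+1%:R *: rho)) - n.+1%:R * b) = 0.
Proof.
pose z0 := pt (gp (- (n.+1%:R * a)) th) (y - n.+1%:R *: rho).
move=> h; rewrite -[RHS](l_iter n.+1 z0) iter_skew //.
rewrite big1 => [|i _]; last first.
  have -> : - (n.+1%:R * a) + i%:R * a = (i%:Z - n.+1%:Z)%:~R * a.
    by rewrite intrB -!pmulrn; ring.
  apply: tents_orbit => //; rewrite subr_eq0 eqz_nat.
  by rewrite neq_ltn ltn_ord.
by rewrite addNr addr0 subrK.
Qed.

Let dist_int4 (p q r s : R) : dist_int (- p + q - r + s) <=
  dist_int p + dist_int q + dist_int r + dist_int s.
Proof.
apply: le_trans (dist_intD _ _) _; rewrite lerD2r.
apply: le_trans (dist_intD _ _) _; rewrite dist_intN lerD2r.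
by apply: le_trans (dist_intD _ _) _; rewrite dist_intN.
Qed.

(* Following the orbit of the gap forwards until it returns to its right end
   shows that l on the gap at height th is l at the right end translated by the
   tents; following it backwards, the tents are never met. *)
Lemma l_tents th y : 0 <= th <= 1 ->
  dist_int (l (pt right_end (y + tents (gp 0 th))) - l (pt right_end y)) = 0.
Proof.
move=> h; apply/eqP; rewrite eq_le dist_int_ge0 andbT.
apply/ler_addgt0Pr => e e0; rewrite add0r.
have [eta eta0 H] := @l_near_right (e / 4) ltac:(lra).
(* Both returns, one in the future and one in the past, are to the right of 0, so [l_near_right]
   applies to each. *)
have [n [k nk]] := incommensurable_approx irr_a eta0.
have [m [k' mk]] := incommensurable_approx (incommensurableN irr_a) eta0.
rewrite mulrN in mk; set B := tents _.
have A1 := H _ _ th (y + B + n.+1%:R *: rho) nk h.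
have A2 := H _ _ 1 (y + B + n.+1%:R *: rho) nk h1.
have A3 := l_forward n y h.
have := l_forward n (y + B) h1.
rewrite tents_right addr0 (gap_point1 a 0) -/right_end => A4.
have B1 := H _ _ th (y - m.+1%:R *: rho) mk h.
have B2 := H _ _ 1 (y - m.+1%:R *: rho) mk h1.
have B3 := l_backward m y h.
have := l_backward m y h1; rewrite (gap_point1 a 0) -/right_end => B4.
have -> : l (pt right_end (y + B)) - l (pt right_end y) =
  (l (pt right_end (y + B)) - l (pt (gp 0 th) y)) +
  (l (pt (gp 0 th) y) - l (pt right_end y)) by ring.
apply: le_trans (dist_intD _ _) _.
set X1 := l (pt (gp (n.+1%:R * a) th) _) in A1 A3.
set X3 := l (pt (gp (n.+1%:R * a) 1) _) in A2 A4.
set E := l (pt right_end (y + B + _)) in A1 A2.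
set Y1 := l (pt (gp (- (m.+1%:R * a)) th) _) in B1 B3.
set Y3 := l (pt (gp (- (m.+1%:R * a)) 1) _) in B2 B4.
set E' := l (pt right_end (y - _)) in B1 B2.
(* Each alternating sum telescopes, at the cost of two errors below [e / 4]. *)
have fwd := dist_int4 (X3 - l (pt right_end (y + B)) - n.+1%:R * b) (X3 - E)
  (X1 - E) (X1 - l (pt (gp 0 th) y) - n.+1%:R * b).
have bwd := dist_int4 (l (pt right_end y) - Y3 - m.+1%:R * b) (Y1 - E')
  (Y3 - E') (l (pt (gp 0 th) y) - Y1 - m.+1%:R * b).
rewrite A3 A4 in fwd; rewrite B3 B4 in bwd.
have fE : - (X3 - l (pt right_end (y + B)) - n.+1%:R * b) + (X3 - E) -
   (X1 - E) + (X1 - l (pt (gp 0 th) y) - n.+1%:R * b) =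
   l (pt right_end (y + B)) - l (pt (gp 0 th) y) by ring.
have bE : - (l (pt right_end y) - Y3 - m.+1%:R * b) + (Y1 - E') -
   (Y3 - E') + (l (pt (gp 0 th) y) - Y1 - m.+1%:R * b) =
   l (pt (gp 0 th) y) - l (pt right_end y) by ring.
rewrite fE in fwd; rewrite bE in bwd; lra.
Qed.

(** The fractional part of [c] is the value of tent [j] at a height where the other tents vanish;
    periodicity absorbs the integer part. *)
Lemma l_translate c j y : dist_int
  (l (pt right_end (y + c *: delta_mx ord0 j)) - l (pt right_end y)) = 0.
Proof.
have c01 : 0 <= fracpart c <= 1 by have := frac_itv c; lra.
rewrite -(l_tents y (tent_height_itv j c01)); congr (dist_int (_ - _)).
set w := y + tents _.
have -> : y + c *: delta_mx ord0 j = w + (Num.floor c)%:~R *: delta_mx ord0 j.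
  apply/rowP => i; rewrite !mxE tent_value // /fracpart eqxx /=.
  by case: eqP => _; rewrite ?mulr1 ?mulr0 ?addr0 //; ring.
rewrite -[RHS](@l_periodic _ (pt 0 ((Num.floor c)%:~R *: delta_mx ord0 j))).
  by congr l; apply/rowP => i; rewrite !mxE; case: eqP => _; rewrite ?addr0.
move=> i; rewrite !mxE; case: eqP => _; first exact: rpred0.
by rewrite rpredM // ?intr_int // rpred_nat.
Qed.

Lemma l_fiber y : dist_int (l (pt right_end y) - l (pt right_end 0)) = 0.
Proof.
rewrite [y]row_sum_delta; elim/big_rec: _ => [|j v _ IH].
  by rewrite subrr dist_int_int // rpred0.
apply/eqP; rewrite eq_le dist_int_ge0 andbT -[leRHS]IH [_ + v]addrC.
set v' := v + _.
have -> : l (pt right_end v') - l (pt right_end 0) =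
  (l (pt right_end v') - l (pt right_end v)) +
  (l (pt right_end v) - l (pt right_end 0)) by ring.
by apply: dist_int0_le; exact: l_translate.
Qed.

(** The right end with fibre coordinate 0 returns close to its own fibre, where [l] is constant
    modulo 1. So [n b] is nearly an integer whenever [n a] is slightly above one. *)
Lemma l_dependent : exists u w : int, b = u%:~R * a + w%:~R.
Proof.
apply: (modular_continuity_dependent irr_a) => e e0.
have [eta eta0 H] := l_near_right e0; exists eta => // -[|n] k nk.
  by exists 0; rewrite mul0r subrr normr0.
suff : dist_int (n.+1%:R * b) < e by have [j ->] := dist_intP (n.+1%:R * b); exists j.
have A := H _ _ 1 (0 + n.+1%:R *: rho) nk h1.
have := l_forward n 0 h1; rewrite tents_right addr0 (gap_point1 a 0) -/right_end => A'.
have Z := l_fiber (0 + n.+1%:R *: rho).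
set X := l (pt (gp _ 1) _) in A A'; set E := l (pt right_end (0 + _)) in A Z.
have := dist_int4 (X - l (pt right_end 0) - n.+1%:R * b) (X - E) 0
  (E - l (pt right_end 0)).
rewrite A' Z (dist_int_int (rpred0 _)).
have -> : - (X - l (pt right_end 0) - n.+1%:R * b) + (X - E) - 0 +
  (E - l (pt right_end 0)) = n.+1%:R * b by ring.
by lra.
Qed.

End coboundary.

End skew_product.

(** * Total irrationality and the conclusion *)

Lemma totally_irrational_incommensurable (R : realType) (d : nat)
    (rho : 'rV[R]_d) (j : 'I_d) :
  totally_irrational rho -> incommensurable (rho ord0 j).
Proof.
move=> irr n k e.
have [|_ /(_ j)] := irr k%:~R (fun i => if i == j then n%:R else 0).
  rewrite (bigD1 j) //= eqxx big1 => [|i /negPf ->]; last by rewrite rmorph0 mul0r.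
  by rewrite addr0 addrC ratr_int ratr_nat.
by rewrite eqxx => /eqP; rewrite pnatr_eq0 => /eqP.
Qed.

Lemma totally_irrational_independent (R : realType) (d : nat)
    (rho : 'rV[R]_d) (i j : 'I_d) (u w : int) :
  totally_irrational rho -> i != j ->
  rho ord0 j <> u%:~R * rho ord0 i + w%:~R.
Proof.
move=> irr ij e.
have ji : j != i by rewrite eq_sym.
have [|_ /(_ j)] := irr w%:~R
    (fun m => if m == j then - 1 else if m == i then u%:~R else 0).
  rewrite (bigD1 j) //= eqxx (bigD1 i) //= (negPf ij) eqxx big1 => [|m].
    by rewrite rmorphN rmorph1 !ratr_int e; ring.
  by case/andP=> /negPf -> /negPf ->; rewrite rmorph0 mul0r.
by rewrite eqxx => /eqP; rewrite oppr_eq0 oner_eq0.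
Qed.

(** Entry 1 of [psi] on representatives plays the role of [l], with [b] the entry 1 of [rho]; the
    resulting integer relation contradicts the independence of 1 and the first two entries of
    [rho]. *)
Lemma skew_not_semi_conjugate (R : realType) (d : nat) (rho : 'rV[R]_d.+2) :
  totally_irrational rho ->
  ~ semi_conjugate (descend (skew_map rho)) (torus_rot rho).
Proof.
move=> irr [psi [cpsi _ psiE]]; pose j1 : 'I_d.+2 := lift ord0 ord0.
pose l (z : 'rV[R]_d.+2) := repr (psi (torus_pi z)) ord0 j1.
have [] := @l_dependent R d rho (totally_irrational_incommensurable irr) l
  (rho ord0 j1).
- move=> z e e0; apply: filterS (torus_map_coord_near j1 z cpsi e0) => z' [k].
  exact: le_lt_trans (dist_int_le _ _).
- move=> z k ik; rewrite /l; suff -> : torus_pi (z + k) = torus_pi z by [].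
  by apply/torus_pi_eq; rewrite addrAC subrr add0r.
- move=> z; rewrite /l -(descendE (@skew_equivariant R d rho)).
  rewrite -[psi (descend _ _)]/((psi \o descend (skew_map rho)) (torus_pi z)) psiE /=.
  have /torus_pi_eq/(_ j1) : torus_pi (repr (torus_rot rho (psi (torus_pi z)))) =
      torus_pi (repr (psi (torus_pi z)) + rho) by exact: reprK.
  by rewrite !mxE opprD addrA => /dist_int_int.
by move=> u [w]; apply: totally_irrational_independent.
Qed.

Theorem proposition2p1 (R : realType) (d : nat) (hd : (2 <= d)%N)
    (rho : 'rV[R]_d) (hrho : totally_irrational rho) :
  exists (f : torus R d -> torus R d) (F : 'rV[R]_d -> 'rV[R]_d),
    [/\ irrational_pseudo_rotation f F rho,
        bounded_mean_motion F rho
      & ~ semi_conjugate f (torus_rot rho)].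
Proof.
case: d hd rho hrho => [//|[//|d]] _ rho hrho.
have bmm := skew_bounded (totally_irrational_incommensurable hrho).
exists (descend (skew_map rho)), (skew_map rho); split=> //.
  split=> //.
  - exact: descend_homeo0 (@skew_equivariant R d rho)
      (@skew_inv_equivariant R d rho) (@skew_continuous R d rho)
      (@skew_inv_continuous R d rho) (@skewK R d rho) (@skew_invK R d rho).
  - split; first exact: skew_continuous.
    by apply/funext => z /=; rewrite descendE //; exact: skew_equivariant.
  - exact: bounded_rotation_set.
exact: skew_not_semi_conjugate.
Qed.
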